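(* Let $n \ge 1$ and $k \ge 0$ be integers. There exists a bijection between the set of permutations of $\{1,\ldots,n\}$ with exactly $k$ descents and the set of permutation tableaux of length $n$ with exactly $k$ columns.
   Context: Permutations of $\{1,\ldots,n\}$ are written in one-line notation $\sigma=(\sigma(1),\ldots,\sigma(n))$. A descent of $\sigma$ is an entry $i\in\{1,\ldots,n\}$ such that, if $\sigma(j)=i$, then $j<n$ and $\sigma(j)>\sigma(j+1)$. (For example, the descents of $(2,4,8,5,1,6,3,7)$ are $5$, $6$ and $8$.) A shape is the Ferrers diagram of a partition $\lambda=(\lambda_1\ge\lambda_2\ge\cdots\ge\lambda_m\ge 0)$, drawn with row $1$ at the top and rows left-justified, where row $r$ has $\lambda_r$ cells, in columns $1,\ldots,\lambda_r$ from left to right. Parts equal to $0$ (empty rows) are allowed and are counted as rows, so that shapes with different numbers of zero parts are different. The number of rows is $m$ and the number of columns is $\lambda_1$. A permutation tableau is a shape together with a filling of its cells with $0$'s and $1$'s such that: (1) each column contains at least one $1$; (2) there is no $0$ which has both a $1$ above it in the same column and a $1$ to its left in the same row. The length of a permutation tableau is the half perimeter of its shape, that is, its number of rows (empty rows included) plus its number of columns. Equivalently, it is the number of unit South and West steps of the boundary path of the shape from top-right to bottom-left, where each South step corresponds to a row and each West step to a column. *)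

(* Defs.v *)
From HB Require Import structures.
From mathcomp Require Import all_boot all_fingroup.
Set Implicit Arguments.
Unset Strict Implicit.
Unset Printing Implicit Defensive.

(* Permutations of {1, ..., n} are elements of 'S_n, i.e. permutations of
   {0, ..., n - 1}: positions and entries are both shifted down by 1. A descent
   is an entry, not a position. *)
Definition descents (n : nat) (s : 'S_n) : {set 'I_n} :=
  [set i | [exists j : 'I_n, exists j' : 'I_n,
     [&& s j == i, j' == j.+1 :> nat & s j' < s j]]].

(* A filled diagram is the sequence of its rows, from top to bottom, each row
   being the sequence of its entries from left to right (true is 1, false
   is 0). The underlying partition is then [shape T], the sequence of the row
   lengths; empty rows are kept. Rows and columns are numbered from 0. *)
Definition diagram := seq (seq bool).

Definition is_ferrers (T : diagram) : bool := sorted geq (shape T).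

Definition nrows (T : diagram) : nat := size (shape T).

Definition ncols (T : diagram) : nat := head 0 (shape T).

Definition in_shape (T : diagram) (r c : nat) : bool := c < nth 0 (shape T) r.

(* Only meaningful when [in_shape T r c]; outside the shape it is false. *)
Definition entry (T : diagram) (r c : nat) : bool := nth false (nth [::] T r) c.

Definition has_one (T : diagram) (r c : nat) : bool :=
  in_shape T r c && entry T r c.

Definition has_zero (T : diagram) (r c : nat) : bool :=
  in_shape T r c && ~~ entry T r c.

Definition columns_have_one (T : diagram) : bool :=
  [forall c : 'I_(ncols T), exists r : 'I_(nrows T), has_one T r c].

Definition no_forbidden_zero (T : diagram) : bool :=
  [forall r : 'I_(nrows T), forall c : 'I_(ncols T),
     ~~ [&& has_zero T r c,
            [exists r' : 'I_r, has_one T r' c] &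
            [exists c' : 'I_c, has_one T r c']]].

Record permutation_tableau := PermutationTableau {
  filling :> diagram;
  fillingP : [&& is_ferrers filling, columns_have_one filling
               & no_forbidden_zero filling]
}.

HB.instance Definition _ := [isSub for filling].
HB.instance Definition _ := [Equality of permutation_tableau by <:].

Definition tableau_length (T : permutation_tableau) : nat := nrows T + ncols T.

(* Main.v *)
Require Import Defs.
From mathcomp Require Import all_boot all_fingroup.
From mathcomp Require Import ssralg ssrint zify ring.
Set Implicit Arguments.
Unset Strict Implicit.
Unset Printing Implicit Defensive.

(** Both the tableaux and the permutations are counted through recurrences on
    [n], and the two counts agree because the recurrences are equivalent.

    Permutations: inserting the entry [n] into a permutation of [0, ..., n - 1]
    with [k] descents creates no descent at [k + 1] of the positions (at the
    end, or inside a descent) and one descent at the [n - k] others. The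
    numbers of permutations by descents are thus the Eulerian numbers
    ([sum_word_desS], [eulerianSS]).

    Tableaux: follow the boundary path to its last step. If it is a South step,
    the tableau ends with an empty row, which can be removed ([south]). If it is
    a West step, every row is non-empty and the leftmost column can be removed
    ([west]). Conversely, call a row restricted when it has a 0 below a 1. A new
    leftmost column must carry 0 in the restricted rows, is arbitrary elsewhere
    as long as it has a 1, and newly restricts exactly the rows where it has a 0
    below a 1. Hence, recording a tableau with [u] unrestricted rows by
    [m ^ u], a South step sends [m ^ u] to [m * m ^ u], and the West steps send
    it, in total, to [m * (m + 1) ^ u - m * m ^ u] ([sum_still_free]). So the
    generating polynomial [P_n(m, y)], with [y] counting columns, satisfies
    [P_(n + 1) = S P_n], where [S f (m) = m * (y * f (m + 1) + (1 - y) * f m)].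

    This recurrence shifts [m], so it cannot be specialised to [m = 1]. But
    with [D_n f = (m + n * y) * f + y * (1 - y) * df/dy], a direct computation
    gives [S D_(n - 1) = D_n S]; since [S 1 = D_0 1 = m], it follows by
    induction that [P_(n + 1) = D_n P_n] as well
    ([shift_recurrence_eulerian]). Now [m] is a mere parameter, and at [m = 1]
    this is the recurrence of the Eulerian numbers. *)

(** * From the shifting recurrence to the Eulerian one *)

Section TwoRecurrences.
Import GRing.Theory.
Local Open Scope ring_scope.

(** Coefficient by coefficient in [y], this is the commutation of the two
    operators: with both recurrences expressed at the level below, the identity
    at level [n + 1] is the one between [S D_(n - 1)] and [D_n S]. *)
Lemma shift_recurrence_eulerian (w : nat -> nat -> nat -> int) :
    (forall m k, w m 0%N k = (k == 0%N)%:R) ->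
    (forall m n, w m n.+1 0%N = m%:R * w m n 0%N) ->
    (forall m n k, w m n.+1 k.+1 =
       m%:R * (w m.+1 n k + w m n k.+1 - w m n k)) ->
  forall m n k, w m n.+1 k.+1 =
    (m + k).+1%:R * w m n k.+1 + (n%:R - k%:R) * w m n k.
Proof.
move=> w0 wS0 wSS m n; elim: n m => [|n IHn] m k.
  rewrite wSS !w0 /=; case: k => [|k] /=; ring.
rewrite wSS; case: k => [|k].
  rewrite [in LHS]IHn !wS0 wSS -!natr1 !natrD; ring.
rewrite [in LHS]IHn [in LHS]IHn [in LHS]IHn [in RHS]wSS [in RHS]wSS.
rewrite -!natr1 !natrD -!natr1; ring.
Qed.

End TwoRecurrences.

(** * Descents and insertion of a maximal entry *)

(** Descents of the word [a :: w]; keeping the first letter apart makes the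
    induction on [w] go through. *)
Definition des (a : nat) (w : seq nat) : nat := count id (pairmap gtn a w).

Definition word_des (w : seq nat) : nat :=
  if w is a :: w' then des a w' else 0.

Definition ins (i x : nat) (w : seq nat) : seq nat :=
  take i w ++ x :: drop i w.

Lemma des_le_size a w : des a w <= size w.
Proof. by rewrite -(size_pairmap gtn a w) count_size. Qed.

Lemma word_des_le_size w : word_des w <= size w.
Proof. by case: w => //= a w; apply: leqW; apply: des_le_size. Qed.

(** The insertions considered here put [x] after [a]: the ones that create no
    descent are those inside one of the [des a w] descents, and the one at the
    end. The summand [F] is arbitrary because the induction hypothesis is used
    with [F] shifted by the contribution of the first pair of letters. *)
Lemma sum_des_ins (F : nat -> nat) x a w : all (gtn x) (a :: w) ->
  \sum_(i < (size w).+1) F (des a (ins i x w)) =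
    (des a w).+1 * F (des a w) + (size w - des a w) * F (des a w).+1.
Proof.
elim: w a F => [|b w IHw] a F /=.
  move=> /andP[ltax _]; rewrite big_ord1 /des /= ltnNge ltnW //=.
  by rewrite addn0 mul1n addn0.
case/and3P=> ltax ltbx ltwx; rewrite big_ord_recl.
rewrite (IHw b (fun d => F ((b < a) + d))) /=; last by rewrite ltbx.
have ltxaF : (x < a) = false by rewrite ltnNge ltnW.
rewrite /ins /des /= ltbx ltxaF -/(des b w).
have := des_le_size b w; move: (des b w) => d led.
by case: (b < a); rewrite /= ?add0n ?add1n ?subSS ?(subSn led) !mulSn; lia.
Qed.

Lemma sum_word_des_ins (F : nat -> nat) x w : all (gtn x) w ->
  \sum_(i < (size w).+1) F (word_des (ins i x w)) =
    (word_des w).+1 * F (word_des w) +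
    (size w - word_des w) * F (word_des w).+1.
Proof.
case: w => [_|a w altx]; first by rewrite big_ord1 /ins /= /des /=; nia.
rewrite big_ord_recl (sum_des_ins F altx).
have /andP[/= ltax _] := altx; rewrite /ins /= {1}/des /= ltax -/(des a w).
have ledw := des_le_size a w.
by rewrite add1n (subSn ledw) !mulSn; lia.
Qed.

(** * The Eulerian numbers *)

Definition word n (s : 'S_n) : seq nat := [seq val (s i) | i <- enum 'I_n].

Lemma size_word n (s : 'S_n) : size (word s) = n.
Proof. by rewrite size_map size_enum_ord. Qed.

Lemma nth_word n (s : 'S_n) (i : 'I_n) : nth 0 (word s) i = s i.
Proof. by rewrite (nth_map i) ?size_enum_ord // nth_ord_enum. Qed.

Lemma word_lt n (s : 'S_n) : all (gtn n) (word s).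
Proof. by apply/allP => _ /mapP[i _ ->] /=. Qed.

Lemma word_desE w :
  word_des w =
  \sum_(i < size w) ((i.+1 < size w) && (nth 0 w i.+1 < nth 0 w i)).
Proof.
case: w => [|a w]; first by rewrite big_ord0.
rewrite big_ord_recr /= ltnn addn0 /des -sum1_count.
rewrite (big_nth false) big_mkcond size_pairmap big_mkord.
by apply: eq_bigr => i _; rewrite ltnS ltn_ord (nth_pairmap 0) //=; case: ltnP.
Qed.

(** A descent is an entry; the permutation itself is the bijection between the
    positions where the word decreases and these entries. *)
Lemma card_descents n (s : 'S_n) : #|descents s| = word_des (word s).
Proof.
rewrite word_desE size_word.
transitivity #|s @^-1: descents s|.
  rewrite on_card_preimset //; apply: onW_bij.
  by exists s^-1%g; [apply: permK|apply: permKV].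
rewrite -sum1_card big_mkcond; apply: eq_bigr => j _ /=.
rewrite !inE nth_word.
case: ifP => [/existsP[j0 /existsP[j1 /and3P[/eqP/perm_inj-> /eqP eqj lts]]]|].
  by rewrite -eqj ltn_ord nth_word lts.
move=> ndes; case: ltnP => //= ltj; rewrite (nth_word s (Ordinal ltj)).
case: ltnP => // lts; case/existsP: ndes.
by exists j; apply/existsP; exists (Ordinal ltj); rewrite !eqxx.
Qed.

Lemma word_lift n (i : 'I_n.+1) (s : 'S_n) :
  word (lift_perm i ord_max s) = ins i n (word s).
Proof.
have lein : i <= n by rewrite -ltnS.
apply: (@eq_from_nth _ 0) => [|j].
  by rewrite size_word size_cat /= size_takel ?size_drop size_word //; lia.
rewrite size_word => ltj; rewrite -[j]/(val (Ordinal ltj)) nth_word.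
move: (Ordinal ltj) => {ltj}j; rewrite nth_cat size_takel ?size_word //.
case: (unliftP i j) => [k ->|->]; last by rewrite lift_perm_id ltnn subnn.
rewrite lift_perm_lift /= [in LHS]/bump leqNgt ltn_ord add0n /bump.
case: (leqP i k) => [leik|ltki] /=.
  by rewrite add1n ltnNge leqW //= subSn //= nth_drop subnKC // nth_word.
by rewrite add0n ltki nth_take // nth_word.
Qed.

(** Injectivity recovers the position [i] from that of the largest entry;
    surjectivity is then a count, [n.+1 * n`! = n.+1`!]. *)
Lemma lift_perm_bij n :
  bijective (fun p : 'I_n.+1 * 'S_n => lift_perm p.1 ord_max p.2).
Proof.
apply: inj_card_bij => [[i s] [j t] /= eq_st|]; last first.
  by rewrite card_prod !card_Sn card_ord.
have eq_ij : i = j.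
  apply: (@perm_inj _ (lift_perm i ord_max s)).
  by rewrite [in RHS]eq_st !lift_perm_id.
rewrite -eq_ij in eq_st *; congr (_, _); apply/permP => k.
have /permP/(_ (lift i k)) := eq_st.
by rewrite !lift_perm_lift => /lift_inj.
Qed.

Definition eulerian n k := \sum_(s : 'S_n) (word_des (word s) == k).

Lemma sum_word_desS n (F : nat -> nat) :
  \sum_(s : 'S_n.+1) F (word_des (word s)) =
  \sum_(s : 'S_n) ((word_des (word s)).+1 * F (word_des (word s)) +
     (n - word_des (word s)) * F (word_des (word s)).+1).
Proof.
rewrite (reindex _ (onW_bij _ (lift_perm_bij n))) /=.
rewrite -(pair_bigA _ (fun i s => F (word_des (word (lift_perm i ord_max s))))).
rewrite exchange_big /=; apply: eq_bigr => s _.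
have := sum_word_des_ins F (word_lt s); rewrite size_word => <-.
by apply: eq_bigr => i _; rewrite word_lift.
Qed.

Lemma eulerian0 k : eulerian 0 k = (k == 0).
Proof.
rewrite /eulerian (eq_bigr (fun=> nat_of_bool (k == 0))) => [|s _].
  by rewrite sum_nat_const card_Sn mul1n.
by rewrite (size0nil (size_word s)) eq_sym.
Qed.

Lemma eulerianS0 n : eulerian n.+1 0 = eulerian n 0.
Proof.
rewrite /eulerian (sum_word_desS n (fun d => d == 0)).
by apply: eq_bigr => s _; case: word_des => [|d] /=; rewrite !(muln0, muln1).
Qed.

(** The usual factor [n - k] is split, with [k] on the left, so that the
    identity needs no truncated subtraction. *)
Lemma eulerianSS n k :
  eulerian n.+1 k.+1 + k * eulerian n k =
    k.+2 * eulerian n k.+1 + n * eulerian n k.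
Proof.
rewrite /eulerian (sum_word_desS n (fun d => d == k.+1)) !big_distrr /=.
rewrite -!big_split /=; apply: eq_bigr => s _.
have := word_des_le_size (word s); rewrite size_word eqSS.
move: (word_des _) => d ledn.
case: (d =P k.+1) => [->|_]; first by case: eqP; lia.
by case: eqP => [<-|_]; nia.
Qed.

(** * Diagrams, validity and restricted rows *)

Definition row (T : diagram) (r : nat) : seq bool := nth [::] T r.

Lemma in_shapeE T r c : in_shape T r c = (c < size (row T r)).
Proof.
rewrite /in_shape /row; case: (ltnP r (size T)) => ltr.
  by rewrite (nth_map [::]).
by rewrite !nth_default ?size_map.
Qed.

Lemma has_oneE T r c : has_one T r c = nth false (row T r) c.
Proof.
rewrite /has_one in_shapeE; case: ltnP => //= lec.
by rewrite nth_default.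
Qed.

Lemma has_zeroE T r c :
  has_zero T r c = (c < size (row T r)) && ~~ nth false (row T r) c.
Proof. by rewrite /has_zero in_shapeE. Qed.

Lemma has_one_nrows T r c : has_one T r c -> r < nrows T.
Proof.
rewrite has_oneE /row /nrows size_map; case: ltnP => // ler.
by rewrite [nth [::] _ _]nth_default ?nth_nil.
Qed.

Lemma ferrers_nth T r r' : is_ferrers T -> r <= r' -> r' < size (shape T) ->
  nth 0 (shape T) r' <= nth 0 (shape T) r.
Proof.
move=> ferT lerr' ltr'; apply: (sorted_leq_nth _ _ 0 ferT) => //.
- by move=> a b c /= leab leca; apply: leq_trans leab.
- by move=> a /=.
- exact: leq_ltn_trans ltr'.
Qed.

Lemma in_shape_ncols T r c : is_ferrers T -> in_shape T r c -> c < ncols T.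
Proof.
move=> ferT inTc; have ltr : r < size (shape T).
  move: inTc; rewrite /in_shape; case: (ltnP r (size (shape T))) => // ler.
  by rewrite nth_default.
apply: leq_trans inTc _; rewrite /ncols -nth0.
apply: ferrers_nth ferT _ _ => //.
Qed.

Definition valid (T : diagram) : bool :=
  [&& is_ferrers T, columns_have_one T & no_forbidden_zero T].

Definition restricted (T : diagram) (r : nat) : bool :=
  [exists c : 'I_(size (row T r)), exists r' : 'I_r,
     has_zero T r c && has_one T r' c].

Lemma restrictedP T r :
  reflect (exists c r', [/\ r' < r, has_zero T r c & has_one T r' c])
          (restricted T r).
Proof.
apply: (iffP existsP) => [[c /existsP[r' /andP[z o]]]|[c [r' [ltr z o]]]].
  by exists c, r'.
have ltc : c < size (row T r) by move: z; rewrite has_zeroE => /andP[].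
by exists (Ordinal ltc); apply/existsP; exists (Ordinal ltr); rewrite z.
Qed.

Lemma columnsP T :
  reflect (forall c, c < ncols T -> exists r, has_one T r c)
          (columns_have_one T).
Proof.
apply: (iffP forallP) => [colT c ltc | colT c].
  by have /existsP[r o] := colT (Ordinal ltc); exists r.
have [r o] := colT c (ltn_ord c).
by apply/existsP; exists (Ordinal (has_one_nrows o)).
Qed.

Lemma no_forbiddenP T : is_ferrers T ->
  reflect (forall r c r' c', r' < r -> c' < c ->
             has_zero T r c -> has_one T r' c -> ~~ has_one T r c')
          (no_forbidden_zero T).
Proof.
move=> ferT; apply: (iffP forallP) => [nofT r c r' c' ltr ltc z o | nofT r].
  have inTc : in_shape T r c by case/andP: z.
  have ltcn := in_shape_ncols ferT inTc.
  have ltrn : r < nrows T.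
    move: inTc; rewrite /nrows /in_shape; case: (ltnP r (size (shape T))) => // ler.
    by rewrite nth_default.
  apply/negP => o'; have /forallP/(_ (Ordinal ltcn))/negP[] := nofT (Ordinal ltrn).
  rewrite z /=; apply/andP; split; apply/existsP.
    by exists (Ordinal ltr).
  by exists (Ordinal ltc).
apply/forallP => c; apply/and3P => -[z /existsP[r' o] /existsP[c' o']].
by have /negP := nofT r c r' c' (ltn_ord r') (ltn_ord c') z o.
Qed.

(** * Adding an empty row at the bottom *)

Definition south (T : diagram) : diagram := rcons T [::].

Lemma row_south T r : row (south T) r = row T r.
Proof. exact: nth_rcons_default. Qed.

Lemma has_one_south T r c : has_one (south T) r c = has_one T r c.
Proof. by rewrite !has_oneE row_south. Qed.

Lemma has_zero_south T r c : has_zero (south T) r c = has_zero T r c.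
Proof. by rewrite !has_zeroE row_south. Qed.

Lemma nrows_south T : nrows (south T) = (nrows T).+1.
Proof. by rewrite /nrows !size_map size_rcons. Qed.

Lemma ncols_south T : ncols (south T) = ncols T.
Proof. by case: T. Qed.

Lemma ferrers_south T : is_ferrers (south T) = is_ferrers T.
Proof.
rewrite /is_ferrers /south /shape map_rcons; case: T => //= a T.
by rewrite rcons_path andbT.
Qed.

Lemma restricted_south T r : restricted (south T) r = restricted T r.
Proof.
by apply/restrictedP/restrictedP => -[c [r']];
  rewrite ?has_zero_south ?has_one_south; exists c, r';
  rewrite ?has_zero_south ?has_one_south.
Qed.

Lemma valid_south T : valid (south T) = valid T.
Proof.
rewrite /valid ferrers_south; case: (boolP (is_ferrers T)) => //= ferT.
have ferS : is_ferrers (south T) by rewrite ferrers_south.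
congr (_ && _).
  apply/columnsP/columnsP; rewrite ncols_south => colT c /colT[r];
  by rewrite ?has_one_south => o; exists r; rewrite ?has_one_south.
by apply/(no_forbiddenP ferS)/(no_forbiddenP ferT) => nofT r c r' c';
  have := nofT r c r' c'; rewrite !has_zero_south !has_one_south.
Qed.

(** * Adding a column on the left *)

Definition west (x : seq bool) (T : diagram) : diagram :=
  [seq p.1 :: p.2 | p <- zip x T].

Section West.
Variables (x : seq bool) (T : diagram).
Hypothesis size_x : size x = size T.

Lemma size_west : size (west x T) = size T.
Proof. by rewrite size_map size2_zip ?size_x. Qed.

Lemma row_west r : r < size T -> row (west x T) r = nth false x r :: row T r.
Proof.
move=> ltr; rewrite /row (nth_map (false, [::])) ?nth_zip //=.
by rewrite size2_zip ?size_x.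
Qed.

Lemma row_west_default r : size T <= r -> row (west x T) r = [::].
Proof. by move=> ler; rewrite /row nth_default ?size_west. Qed.

Lemma has_one_west0 r : has_one (west x T) r 0 = nth false x r.
Proof.
rewrite has_oneE; case: (ltnP r (size T)) => ltr; first by rewrite row_west.
by rewrite row_west_default // [RHS]nth_default // size_x.
Qed.

Lemma has_one_westS r c : has_one (west x T) r c.+1 = has_one T r c.
Proof.
rewrite !has_oneE; case: (ltnP r (size T)) => ltr; first by rewrite row_west.
by rewrite row_west_default // /row [nth [::] T r]nth_default ?nth_nil.
Qed.

Lemma has_zero_west0 r :
  has_zero (west x T) r 0 = (r < size T) && ~~ nth false x r.
Proof.
rewrite has_zeroE; case: (ltnP r (size T)) => ltr; first by rewrite row_west.
by rewrite row_west_default.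
Qed.

Lemma has_zero_westS r c : has_zero (west x T) r c.+1 = has_zero T r c.
Proof.
rewrite !has_zeroE; case: (ltnP r (size T)) => ltr; first by rewrite row_west.
by rewrite row_west_default // /row [nth [::] T r]nth_default.
Qed.

Lemma shape_west : shape (west x T) = map S (shape T).
Proof.
rewrite /shape /west -!map_comp -[in RHS](@unzip2_zip _ _ x T) ?size_x //.
by rewrite -map_comp.
Qed.

Lemma nrows_west : nrows (west x T) = nrows T.
Proof. by rewrite /nrows shape_west size_map. Qed.

Lemma ncols_west : 0 < size T -> ncols (west x T) = (ncols T).+1.
Proof. by rewrite /ncols shape_west; case: T. Qed.

Lemma ferrers_west : is_ferrers (west x T) = is_ferrers T.
Proof. by rewrite /is_ferrers shape_west sorted_map. Qed.

Lemma restricted_west r : r < size T ->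
  restricted (west x T) r =
    restricted T r || (~~ nth false x r && has id (take r x)).
Proof.
move=> ltr; apply/restrictedP/orP => [[[|c] [r' []]]|].
- rewrite has_zero_west0 ltr has_one_west0 /= => ltr' z o; right; rewrite z /=.
  by apply/(has_nthP false); exists r';
    rewrite ?size_takel ?nth_take ?size_x // ltnW.
- rewrite has_zero_westS has_one_westS => ltr' z o; left.
  by apply/restrictedP; exists c, r'.
case=> [/restrictedP[c [r' [ltr' z o]]]|/andP[z /(has_nthP false)[r']]].
  by exists c.+1, r'; rewrite has_zero_westS has_one_westS.
rewrite size_takel ?size_x ?(ltnW ltr) // => ltr'; rewrite nth_take // => o.
by exists 0, r'; rewrite has_zero_west0 has_one_west0 ltr.
Qed.

(** A 1 of the new column lies to the left of everything in its row, so it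
    conflicts exactly with the restricting 0s of that row; the 0s of the new
    column have nothing to their left and conflict with nothing. *)
Lemma valid_west : 0 < size T ->
  valid (west x T) =
  [&& valid T, has id x &
    all (fun r => nth false x r ==> ~~ restricted T r) (iota 0 (size T))].
Proof.
move=> T0; rewrite /valid ferrers_west; case: (boolP (is_ferrers T)) => //= ferT.
have ferW : is_ferrers (west x T) by rewrite ferrers_west.
apply/andP/and3P => [[/columnsP colW /(no_forbiddenP ferW) nofW]|].
  split; first (apply/andP; split).
  - apply/columnsP => c; rewrite -ltnS -ncols_west // => /colW[r].
    by rewrite has_one_westS; exists r.
  - apply/(no_forbiddenP ferT) => r c r' c' ltr ltc.
    by have := nofW r c.+1 r' c'.+1 ltr ltc; rewrite has_zero_westS !has_one_westS.
  - have [|r] := colW 0; first by rewrite ncols_west.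
    rewrite has_one_west0 => o; apply/(has_nthP false); exists r => //.
    by case: ltnP o => // ler; rewrite nth_default.
  apply/allP => r _; apply/implyP => o; apply/restrictedP => -[c [r' [ltr z o']]].
  have := nofW r c.+1 r' 0 ltr isT.
  by rewrite has_zero_westS has_one_westS has_one_west0 o => /(_ z o').
case=> /andP[/columnsP colT /(no_forbiddenP ferT) nofT].
move=> /(has_nthP false)[r0 ltr0 o0] /allP freeT.
split.
  apply/columnsP => -[_|c]; first by exists r0; rewrite has_one_west0.
  rewrite ncols_west // ltnS => /colT[r o].
  by exists r; rewrite has_one_westS.
apply/(no_forbiddenP ferW) => r [|c] r' [|c'] // ltr ltc.
  rewrite has_zero_westS has_one_westS has_one_west0 => z o.
  apply/negP => o'.
  have ltrT : r < size T.
    by rewrite -size_x; case: ltnP o' => // ler; rewrite nth_default.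
  have := freeT r; rewrite mem_iota o' ltrT => /(_ isT)/negP[].
  by apply/restrictedP; exists c, r'.
by rewrite has_zero_westS !has_one_westS; apply: nofT.
Qed.

End West.

(** * Unrestricted rows and the fillings of a new column *)

Definition free (T : diagram) : seq bool :=
  [seq ~~ restricted T r | r <- iota 0 (size T)].

Lemma size_free T : size (free T) = size T.
Proof. by rewrite size_map size_iota. Qed.

Lemma nth_free T r : r < size T -> nth false (free T) r = ~~ restricted T r.
Proof. by move=> ltr; rewrite (nth_map 0) ?size_iota // nth_iota. Qed.

Lemma free_south T : free (south T) = rcons (free T) true.
Proof.
rewrite /free size_rcons -addn1 iotaD map_cat /= cats1 restricted_south.
congr rcons; first by apply: eq_map => r; rewrite restricted_south.
apply/restrictedP => -[c [r' [_]]].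
by rewrite has_zeroE /row nth_default.
Qed.

(** The columns with no 1 facing a [false] of [u], the list of flags that tells
    which rows are unrestricted. *)
Fixpoint fills (u : seq bool) : seq (seq bool) :=
  if u is b :: u' then
    [seq false :: x | x <- fills u'] ++
    (if b then [seq true :: x | x <- fills u'] else [::])
  else [:: [::]].

(** The flags after the column [x] is added to rows with flags [u]; [seen]
    records whether [x] already had a 1 above. *)
Fixpoint still_free (seen : bool) (u x : seq bool) : seq bool :=
  match u, x with
  | b :: u', a :: x' => (b && (a || ~~ seen)) :: still_free (seen || a) u' x'
  | _, _ => [::]
  end.

Lemma mem_cons_map (a : bool) (x : seq bool) b s :
  (a :: x \in [seq b :: y | y <- s]) = (a == b) && (x \in s).
Proof.
apply/mapP/andP => [[y ys [-> ->]]|[/eqP-> xs]]; first by rewrite eqxx.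
by exists x.
Qed.

Lemma mem_fills u x : x \in fills u =
  (size x == size u) &&
  all (fun r => nth false x r ==> nth false u r) (iota 0 (size u)).
Proof.
elim: u x => [|b u IHu] [|a x] //=.
  rewrite mem_cat; apply/negbTE/norP; split; first by apply/mapP => -[].
  by case: b => //; apply/mapP => -[].
rewrite mem_cat mem_cons_map eqSS -[1]addn0 iotaDl all_map.
rewrite (eq_all (a2 := fun r => nth false x r ==> nth false u r)) //.
rewrite andbCA -IHu; case: b => /=.
  by rewrite mem_cons_map implybT -andb_orl; case: a.
by rewrite in_nil orbF implybF; case: a.
Qed.

Lemma uniq_fills u : uniq (fills u).
Proof.
have inj_cons b : injective (cons b : seq bool -> seq bool) by move=> x y [].
elim: u => //= b u IHu; rewrite cat_uniq map_inj_uniq // IHu /=.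
case: b => //=; rewrite map_inj_uniq // IHu andbT.
by apply/hasPn => _ /mapP[x _ ->]; apply/mapP => -[].
Qed.

Lemma size_still_free seen u x : size x = size u ->
  size (still_free seen u x) = size u.
Proof. by elim: u seen x => [|b u IHu] seen [|a x] //= [/IHu->]. Qed.

Lemma nth_still_free seen u x r : size x = size u ->
  nth false (still_free seen u x) r =
  nth false u r && (nth false x r || ~~ (seen || has id (take r x))).
Proof.
elim: u seen x r => [|b u IHu] seen [|a x] [|r] //= [size_x].
  by rewrite orbF.
by rewrite IHu // orbA.
Qed.

Lemma free_west x T : size x = size T ->
  free (west x T) = still_free false (free T) x.
Proof.
move=> size_x; have size_xf : size x = size (free T) by rewrite size_free.
apply: (@eq_from_nth _ false) => [|r].
  by rewrite size_still_free // !size_free size_west.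
rewrite size_free size_west // => ltr.
rewrite nth_still_free // !nth_free ?size_west // restricted_west //.
by rewrite negb_or negb_and negbK.
Qed.

(** Once a 1 has been placed, each unrestricted row has the choice between 1,
    which keeps it unrestricted (weight [m]), and 0, which restricts it
    (weight 1). *)
Lemma sum_still_free_seen m u :
  \sum_(x <- fills u) m ^ count id (still_free true u x) = m.+1 ^ count id u.
Proof.
elim: u => [|b u IHu]; first by rewrite big_seq1.
rewrite /= big_cat big_map /=.
under eq_bigr do rewrite andbF add0n.
rewrite IHu; case: b; last by rewrite big_nil addn0.
rewrite big_map /=; under eq_bigr do rewrite add1n expnS.
by rewrite -big_distrr /= IHu add1n expnS mulSn.
Qed.

(** Summing over the place of the topmost 1 gives a geometric sum,
    [m * ((m + 1) ^ u - m ^ u)] where [u] unrestricted rows are available. *)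
Lemma sum_still_free m u :
  \sum_(x <- fills u | has id x) m ^ count id (still_free false u x)
    + m * m ^ count id u = m * m.+1 ^ count id u.
Proof.
elim: u => [|b u IHu]; first by rewrite big_mkcond big_seq1.
rewrite /= big_cat big_map /=; case: b => /=; last first.
  by rewrite big_nil addn0.
under eq_bigr do rewrite add1n expnS.
rewrite -big_distrr big_map /=.
under [X in _ + X + _]eq_bigr do rewrite add1n expnS.
rewrite -big_distrr /= sum_still_free_seen !add1n !expnS mulSn mulnDr -IHu; lia.
Qed.

(** * Enumerating the tableaux *)

(** One South or West step at a time, with [n] the length and [k] the number of
    columns. *)
Fixpoint tableaux (n k : nat) : seq diagram :=
  if n is n'.+1 then
    [seq south T | T <- tableaux n' k] ++
    (if k is k'.+1 then
       [seq west x T | T <- tableaux n' k',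
                       x <- [seq x <- fills (free T) | has id x]]
     else [::])
  else if k == 0 then [:: [::]] else [::].

(** The last step of the boundary path. If the last row is non-empty then, row
    lengths being weakly decreasing, all rows are. *)
Lemma diagram_case (T : diagram) : is_ferrers T -> 
  [\/ T = [::], exists T', T = south T' |
      exists x T', [/\ 0 < size T', size x = size T' & T = west x T']].
Proof.
case/lastP: T => [|T l]; first by constructor 1.
case: l => [|b l] ferT; first by constructor 2; exists T.
constructor 3; set T1 := rcons T _ in ferT *.
have all1 : all (fun w => 0 < size w) T1.
  apply/(all_nthP [::]) => r; rewrite size_rcons => ltr.
  have : nth 0 (shape T1) (size T) <= nth 0 (shape T1) r.
    apply: ferrers_nth => //.
    by rewrite size_map size_rcons.
  rewrite /shape (nth_map [::]) ?size_rcons // (nth_map [::]) ?size_rcons //.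
  by rewrite [nth _ T1 (size T)]nth_rcons ltnn eqxx /=; apply: leq_trans.
exists (map (head false) T1), (map behead T1).
split; rewrite ?size_map ?size_rcons //.
elim: T1 all1 {ferT} => //= w T1 IHT /andP[w0 /IHT eqT].
by rewrite {1}eqT; case: w w0.
Qed.

Lemma valid_nil : valid [::].
Proof. by apply/and3P; split=> //; apply/forallP => -[]. Qed.

Lemma mem_tableaux n k T :
  T \in tableaux n k = [&& valid T, nrows T + ncols T == n & ncols T == k].
Proof.
have valid_ferrers U : valid U -> is_ferrers U by case/and3P.
apply/idP/idP.
  elim: n k T => [|n IHn] k T /=.
    by case: k => // /[!inE]/eqP->; rewrite valid_nil.
  rewrite mem_cat => /orP[/mapP[U /IHn/and3P[validU nU kU] ->]|].
    by rewrite valid_south validU ncols_south kU nrows_south addSn eqSS nU.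
  case: k => // k /allpairsPdep[U [x [/IHn/and3P[validU nU kU]]]].
  rewrite mem_filter mem_fills size_free => /and3P[x0 /eqP size_x freex] ->.
  have U0 : 0 < size U by rewrite -size_x; case: (x) x0.
  rewrite valid_west // ncols_west // nrows_west // addnS !eqSS nU kU.
  rewrite validU x0 !andbT.
  apply/allP => r rU; have := allP freex r rU; rewrite nth_free //.
  by move: rU; rewrite mem_iota.
case/and3P => validT /eqP lenT /eqP <-.
elim: n T validT lenT => [|n IHn] T validT.
  by case: T {validT} => // r T.
case: (diagram_case (valid_ferrers _ validT)) =>
    [-> //|[U eqT]|[x [U [U0 size_x eqT]]]].
  rewrite {T}eqT in validT *; rewrite valid_south in validT.
  rewrite nrows_south ncols_south addSn => -[nU] /=.
  by rewrite mem_cat map_f ?IHn.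
rewrite {T}eqT in validT *.
rewrite valid_west // in validT; have /and3P[validU x0 freex] := validT.
rewrite nrows_west // ncols_west // addnS => -[nU] /=.
rewrite mem_cat; apply/orP; right.
apply/allpairsPdep; exists U, x; split=> //; first by rewrite IHn.
rewrite mem_filter x0 mem_fills size_free size_x eqxx /=.
apply/allP => r rU; have := allP freex r rU; rewrite nth_free //.
by move: rU; rewrite mem_iota.
Qed.

Lemma west_inj x T x' T' : size x = size T -> size x' = size T' ->
  west x T = west x' T' -> x = x' /\ T = T'.
Proof.
elim: x T x' T' => [|a x IHx] [|t T] [|a' x'] [|t' T'] //= [sx] [sx'] [-> -> eqw].
by have [-> ->] := IHx _ _ _ sx sx' eqw.
Qed.

Lemma uniq_tableaux n k : uniq (tableaux n k).
Proof.
elim: n k => [|n IHn] k /=; first by case: k.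
have size_fill T x : x \in [seq x <- fills (free T) | has id x] ->
    size x = size T.
  by rewrite mem_filter mem_fills size_free => /and3P[_ /eqP].
rewrite cat_uniq map_inj_uniq ?IHn /=; last exact: rcons_injl.
case: k => //= k; apply/andP; split.
  apply/hasPn => _ /allpairsPdep[T [x [_ xT ->]]]; apply/mapP => -[U _ eqU].
  (* the last row is empty on one side only; the default row is non-empty *)
  have := congr1 (last [:: false]) eqU.
  rewrite last_rcons; move: (size_fill _ _ xT) => {eqU xT}.
  elim: x T [:: false] (isT : 0 < size [:: false]) => [|a x IHx] [|t T] l l0 //=.
    by move=> _ e; rewrite e in l0.
  by case=> /IHx; apply.
apply: allpairs_uniq_dep => //.
  by move=> T _; rewrite filter_uniq // uniq_fills.
move=> p q /allpairsPdep[T [x [_ /size_fill sx ->]]].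
case/allpairsPdep=> T' [x' [_ /size_fill sx' ->]] /= /west_inj[] //.
by move=> -> ->.
Qed.

(** * Counting the tableaux *)

(** The coefficient of [y ^ k] in the polynomial [P_n(m, y)]. *)
Definition weight (m n k : nat) : nat :=
  \sum_(T <- tableaux n k) m ^ count id (free T).

Lemma weight0 m k : weight m 0 k = (k == 0).
Proof. by rewrite /weight; case: k => [|k] /=; rewrite ?big_seq1 ?big_nil. Qed.

Lemma sum_south m n k :
  \sum_(T <- tableaux n k) m ^ count id (free (south T)) = m * weight m n k.
Proof.
rewrite big_distrr; apply: eq_bigr => T _ /=.
by rewrite free_south -cats1 count_cat /= addn1 expnS.
Qed.

Lemma weightS0 m n : weight m n.+1 0 = m * weight m n 0.
Proof. by rewrite /weight /= cats0 big_map sum_south. Qed.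

Lemma weightSS m n k :
  weight m n.+1 k.+1 + m * weight m n k =
    m * weight m n k.+1 + m * weight m.+1 n k.
Proof.
rewrite {1}/weight /= big_cat big_map sum_south -addnA; congr (_ + _).
rewrite big_allpairs_dep /weight !big_distrr -big_split /=.
apply: eq_bigr => T _; rewrite -sum_still_free big_filter; congr (_ + _).
rewrite big_seq_cond [RHS]big_seq_cond; apply: eq_bigr => x /andP[].
by rewrite mem_fills size_free => /andP[/eqP size_x _] _; rewrite free_west.
Qed.

Lemma weight1 n k : weight 1 n k = size (tableaux n k).
Proof. by rewrite /weight; under eq_bigr do rewrite exp1n; rewrite sum1_size. Qed.

Lemma weight_eulerian m n k :
  weight m n.+1 k.+1 + k * weight m n k =
    (m + k).+1 * weight m n k.+1 + n * weight m n k.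
Proof.
suff : (Posz (weight m n.+1 k.+1) = Posz (m + k).+1 * Posz (weight m n k.+1)
          + (Posz n - Posz k) * Posz (weight m n k))%R by lia.
rewrite -!natz.
apply: (@shift_recurrence_eulerian (fun m n k => (weight m n k)%:R%R)) => {m n k}.
- by move=> m k; rewrite weight0.
- by move=> m n; rewrite weightS0 GRing.natrM.
- by move=> m n k; rewrite !natz; have := weightSS m n k; lia.
Qed.

Lemma size_tableaux n k : size (tableaux n k) = eulerian n k.
Proof.
elim: n k => [|n IHn] [|k]; rewrite ?eulerian0 //.
  by rewrite eulerianS0 -IHn /= cats0 size_map.
apply: (@addIn (k * eulerian n k)).
by rewrite eulerianSS -!IHn -!weight1 weight_eulerian add1n.
Qed.

(** * The bijection *)

Lemma equinumerous_bij (A : finType) (B : eqType) (s : seq B) :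
    uniq s -> (forall b, b \in s) -> #|A| = size s ->
  exists f : A -> B, bijective f.
Proof.
move=> uniq_s in_s card_A.
have ltb b : index b s < #|A| by rewrite card_A index_mem.
exists (fun a => tnth (in_tuple s) (cast_ord card_A (enum_rank a))).
exists (fun b => enum_val (Ordinal (ltb b))) => [a|b].
  apply: enum_rank_inj; rewrite enum_valK; apply: val_inj => /=.
  set i := cast_ord _ _; rewrite (tnth_nth (tnth (in_tuple s) i)) index_uniq //=.
  by rewrite -card_A.
by rewrite enum_valK (tnth_nth b) /= nth_index.
Qed.

Theorem theorem1 (n k : nat) (hn : 1 <= n) :
  exists f : {s : 'S_n | #|descents s| == k} ->
             {T : permutation_tableau | (tableau_length T == n) && (ncols T == k)},
    bijective f.
Proof.
pose ptabs : seq permutation_tableau := pmap insub (tableaux n k).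
pose s : seq {T : permutation_tableau |
              (tableau_length T == n) && (ncols T == k)} :=
  pmap insub ptabs.
have ptabsE T : T \in ptabs = (tableau_length T == n) && (ncols T == k).
  by rewrite mem_pmap_sub mem_tableaux /valid fillingP.
have size_s : size s = size (tableaux n k).
  rewrite size_pmap_sub (eq_in_count (a2 := predT)) => [|T];
    last by rewrite ptabsE.
  rewrite count_predT size_pmap_sub.
  rewrite (eq_in_count (a2 := predT)) ?count_predT // => T.
  by rewrite mem_tableaux => /and3P[].
apply: (@equinumerous_bij _ _ s);
  first by rewrite !pmap_sub_uniq ?uniq_tableaux.
  by move=> T; rewrite mem_pmap_sub ptabsE; apply: (valP T).
rewrite card_sig size_s size_tableaux /eulerian -sum1_card big_mkcond.
by apply: eq_bigr => t _; rewrite inE card_descents; case: eqP.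
Qed.
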